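(* (1) One has $$\lim_{\mathsf{h}\to+\infty}\mathsf{h}^{2/3}\mathbf{E}_{\mathrm{min}}^0=-\frac12\quad\text{and}\quad\lim_{\mathsf{h}\to+\infty}\mathbf{E}_{\mathrm{max}}^0=+\infty.$$ (2) More precisely, when $\mathsf{h}$ tends to infinity, $$\mathsf{h}^{2/3}\mathbf{E}_{\mathrm{min}}^0=-\frac12-\frac1{120}\frac1{\mathsf{h}^2}+\mathcal{O}\left(\frac1{\mathsf{h}^4}\right).$$
   Context: Let $\hbar,m,L_0,V_0>0$. Let $V$ be the $2L_0$-periodic function on $\mathbb{R}$ with $V(x)=V_0(|x|/L_0-1)$ for $x\in[-L_0,L_0]$, and $H=-\frac{\hbar^2}{2m}\frac{d^2}{dx^2}+V$ acting on the Sobolev space $H^2(\mathbb{R})$. Its spectrum is $\sigma(H)=\bigcup_{p\ge 0}[E_{\mathrm{min}}^p,E_{\mathrm{max}}^p]$, where $E_{\mathrm{min}}^0\le E_{\mathrm{max}}^1\le E_{\mathrm{min}}^2\le\dots$ are the eigenvalues of $-\frac{\hbar^2}{2m}\frac{d^2}{dx^2}+V$ on $[-L_0,L_0]$ with periodic boundary conditions, and $E_{\mathrm{max}}^0\le E_{\mathrm{min}}^1\le E_{\mathrm{max}}^2\le\dots$ those with antiperiodic boundary conditions. Set $\theta=\left(\frac{2mL_0^2}{\hbar^2V_0^2}\right)^{1/3}$, $\mathsf{h}=\frac{\hbar}{L_0(2mV_0)^{1/2}}$ (so $\theta V_0=\mathsf{h}^{-2/3}$), $\mathbf{E}_{\mathrm{min}}^0=\theta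 E_{\mathrm{min}}^0$, $\mathbf{E}_{\mathrm{max}}^0=\theta E_{\mathrm{max}}^0$; the rescaled edges depend only on $\mathsf{h}$. *)

(* Defs.v *)
From HB Require Import structures.
From mathcomp Require Import all_boot all_order all_algebra.
From mathcomp Require Import all_classical all_reals all_analysis.
From mathcomp.real_closed Require Export complex.
From mathcomp Require Import ring lra.

Set Implicit Arguments.
Unset Strict Implicit.
Unset Printing Implicit Defensive.

Import Order.TTheory GRing.Theory Num.Theory.
Import numFieldNormedType.Exports.

Local Open Scope classical_set_scope.
Local Open Scope ring_scope.
Local Open Scope complex_scope.

Record params (R : realType) := Params {
  hbar : R;
  mass : R;
  L0 : R;
  V0 : R;
  hbar_gt0 : 0 < hbar;
  mass_gt0 : 0 < mass;
  L0_gt0 : 0 < L0;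
  V0_gt0 : 0 < V0 }.

(* The floor translates x by a multiple of 2 L0 into [-L0, L0[. *)
Definition potential (R : realType) (p : params R) (x : R) : R :=
  let y := x - (Num.floor ((x + L0 p) / (2 * L0 p)))%:~R * (2 * L0 p) in
  V0 p * (`|y| / L0 p - 1).

Lemma potential_periodic (R : realType) (p : params R) (x : R) :
  potential p (x + 2 * L0 p) = potential p x.
Proof.
have L2 : 2 * L0 p != 0 by rewrite mulf_neq0 ?pnatr_eq0 // gt_eqF ?L0_gt0.
have e : (x + 2 * L0 p + L0 p) / (2 * L0 p) = (x + L0 p) / (2 * L0 p) + 1%:~R.
  by rewrite addrAC mulrDl divff.
rewrite /potential e floorDrz ?intr_int // intrKfloor intrD.
set y := x + _ - _; set y' := x - _.
by rewrite (_ : y = y') // /y /y'; ring.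
Qed.

Lemma potentialE (R : realType) (p : params R) (x : R) :
  - L0 p <= x <= L0 p -> potential p x = V0 p * (`|x| / L0 p - 1).
Proof.
have L := L0_gt0 p; have L2 : 0 < 2 * L0 p by rewrite mulr_gt0.
move=> /andP[x1]; rewrite le_eqVlt => /predU1P[->|x2]; rewrite /potential.
  rewrite (_ : (L0 p + L0 p) / _ = 1%:~R); last first.
    by rewrite (_ : L0 p + L0 p = 2 * L0 p) ?divff ?gt_eqF //; ring.
  rewrite intrKfloor mul1r (_ : L0 p - 2 * L0 p = - L0 p) ?normrN //; lra.
rewrite (_ : Num.floor _ = 0) ?mul0r ?subr0 //.
apply: floor_def; rewrite ler_pdivlMr // ltr_pdivrMr // mul0r mul1r; lra.
Qed.

(* u is in H^2(a, b) (continuous representative) with u' = du and u'' = ddu: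
   u and du are absolutely continuous on [a, b] and ddu is in L^2(a, b). *)
Definition real_H2 (R : realType) (a b : R) (u du ddu : R -> R) : Prop :=
  let mu := @lebesgue_measure R in
  [/\ measurable_fun `[a, b] ddu,
      mu.-integrable `[a, b] (fun x => (ddu x ^+ 2)%:E),
      {in `[a, b], forall x, du x = du a + \int[mu]_(t in `[a, x]) ddu t} &
      {in `[a, b], forall x, u x = u a + \int[mu]_(t in `[a, x]) du t}].

Definition H2 (R : realType) (a b : R) (u du ddu : R -> R[i]) : Prop :=
  real_H2 a b (fun x => complex.Re (u x)) (fun x => complex.Re (du x))
    (fun x => complex.Re (ddu x)) /\
  real_H2 a b (fun x => complex.Im (u x)) (fun x => complex.Im (du x))
    (fun x => complex.Im (ddu x)).

(* E is an eigenvalue of - hbar^2/(2m) d^2/dx^2 + V on L^2(-L0, L0), with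
   domain the u in H^2(-L0, L0) such that u(L0) = z u(-L0) and
   u'(L0) = z u'(-L0). Since u is continuous, u is nonzero in L^2 as soon as it
   is nonzero at one point. *)
Definition bloch_eigenvalue (R : realType) (p : params R) (z : R[i]) (E : R) :
    Prop :=
  exists u du ddu : R -> R[i],
  [/\ H2 (- L0 p) (L0 p) u du ddu,
      u (L0 p) = z * u (- L0 p),
      du (L0 p) = z * du (- L0 p),
      exists2 x, x \in `[- L0 p, L0 p] & u x != 0 &
      {ae @lebesgue_measure R, forall x, x \in `[- L0 p, L0 p] ->
        - (hbar p ^+ 2 / (2 * mass p))%:C * ddu x + (potential p x)%:C * u x
        = E%:C * u x}].

(* The smallest element of S; the junk value 0 when S has none. *)
Definition least (R : realType) (S : set R) : R :=
  xget 0 [set e | S e /\ lbound S e].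

Definition Emin0 (R : realType) (p : params R) : R := least (bloch_eigenvalue p 1).

Definition Emax0 (R : realType) (p : params R) : R := least (bloch_eigenvalue p (-1)).

Definition theta (R : realType) (p : params R) : R :=
  (2 * mass p * L0 p ^+ 2 / (hbar p ^+ 2 * V0 p ^+ 2)) `^ (1 / 3).

Definition hsc (R : realType) (p : params R) : R :=
  hbar p / (L0 p * Num.sqrt (2 * mass p * V0 p)).

Definition rEmin0 (R : realType) (p : params R) : R := theta p * Emin0 p.

Definition rEmax0 (R : realType) (p : params R) : R := theta p * Emax0 p.

(* The filter "h tends to +oo" on the set of parameters: the inverse image of
   the filter +oo under hsc. *)
Definition hsc_pinfty (R : realType) : set_system (params R) :=
  [set A | \forall h \near +oo, forall p : params R, hsc p = h -> A p].

Lemma hsc_surj (R : realType) (h : R) : 0 < h -> exists p : params R, hsc p = h.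
Proof.
move=> h0.
have h1 : (0 : R) < 2^-1 by rewrite invr_gt0.
exists (Params h0 h1 (@ltr01 R) (@ltr01 R)); rewrite /hsc /=.
by rewrite divff ?pnatr_eq0 // mul1r mulr1 sqrtr1 divr1.
Qed.

Global Instance hsc_pinfty_filter (R : realType) : Filter (@hsc_pinfty R).
Proof.
rewrite /hsc_pinfty; split=> /= [|A B|A B AB].
- exact: (@filterE _ (pinfty_nbhs R)).
- by apply: (@filterS2 _ (pinfty_nbhs R)) => h hA hB p hp; split; [exact: hA|exact: hB].
- by apply: (@filterS _ (pinfty_nbhs R)) => h hA p hp; apply: AB; exact: hA.
Qed.

Global Instance hsc_pinfty_proper_filter (R : realType) :
  ProperFilter (@hsc_pinfty R).
Proof.
apply: Build_ProperFilter_ex => A FA.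
have [h [h0 Ah]] : exists h : R, 0 < h /\ forall p, hsc p = h -> A p.
  near (pinfty_nbhs R) => h; exists h; split; near: h => //.
  exact: nbhs_pinfty_gt.
by have [p hp] := hsc_surj h0; exists p; exact: Ah.
Unshelve. all: by end_near.
Qed.

Canonical hsc_pinfty_filterType (R : realType) : filter_on (params R) :=
  FilterType (@hsc_pinfty R) (hsc_pinfty_filter R).

(* Main.v *)
(** With t = x / L0, e = E / V0 and lam = 1 / h^2 the eigenvalue equation is
    w'' = lam (|t| - 1 - e) w on [-1, 1].  Its even and odd parts are multiples
    on [0, 1] of the solutions phi e and psi e with Cauchy data (1, 0) and
    (0, 1) at 0, so that e is a periodic eigenvalue iff
    phi'_e(1) psi_e(1) = 0 and an antiperiodic one iff phi_e(1) psi'_e(1) = 0.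
    These are zero sets of continuous functions of e, bounded below since
    e > -1 for every eigenvalue; hence a least eigenvalue exists as soon as
    there is one, which the intermediate value theorem provides.

    For small lam and e in [-1, 0], psi_e(1) > 0, and expanding phi_e in powers
    of lam gives, with b = e + 1/2,
    phi'_e(1) = - lam (b + lam / 120 - lam b^2 / 6) + O(lam^3),
    which locates the zero at e = -1/2 - lam / 120 + O(lam^2).  For
    e <= 1 / (4 lam) both phi_e and psi'_e stay positive, so the least
    antiperiodic eigenvalue is at least h^2 / 4. *)
Require Import Defs.
From HB Require Import structures.
From mathcomp Require Import all_boot all_order all_algebra.
From mathcomp Require Import all_classical all_reals all_analysis.
From mathcomp Require Import measurable_realfun.
From mathcomp Require Import ring lra zify.

Set Implicit Arguments.
Unset Strict Implicit.
Unset Printing Implicit Defensive.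

Import Order.TTheory GRing.Theory Num.Theory.
Import numFieldNormedType.Exports.

Local Open Scope classical_set_scope.
Local Open Scope ring_scope.

(** * Solutions of y'' = lam s y *)

(** Infinite radius of convergence, stated as boundedness at every radius: a form that a recursion
    on coefficients propagates directly. *)
Definition entire (R : realType) (c : R^nat) :=
  forall K : R, 0 <= K -> exists M, forall n, `|c n| * K ^+ n <= M.

Lemma entire_cvg (R : realType) (c : R^nat) (x : R) :
  entire c -> cvgn (pseries c x).
Proof.
move=> /(_ (2 * `|x|) (mulr_ge0 (ler0n _ _) (normr_ge0 _)))[M hM].
have h : cvgn [normed series (fun n => c n * x ^+ n)].
  apply: (@series_le_cvg _ _ (geometric M (2^-1))) => [n|n|n|].
  - exact: normr_ge0.
  - rewrite /= mulr_ge0 ?exprn_ge0 ?invr_ge0 //.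
    by apply: le_trans (hM 0%N); rewrite mulr_ge0 // exprn_ge0 // mulr_ge0.
  - rewrite /= normrM normrX exprVn ler_pdivlMr ?exprn_gt0 //.
    by rewrite -mulrA -exprMn [_ * 2]mulrC.
  - by apply: is_cvg_geometric_series; rewrite ger0_norm ?invr_ge0 // invf_lt1 ?ltr1n.
exact: normed_cvg h.
Qed.

(** The factor n + 1 is at most 2^(n+1), so the bound at radius 2 (K + 1) absorbs it. *)
Lemma entire_diffs (R : realType) (c : R^nat) :
  entire c -> entire (pseries_diffs c).
Proof.
move=> hc K K0.
have K1 : 0 <= 2 * (K + 1) by lra.
have [M hM] := hc _ K1.
exists M => n; rewrite /pseries_diffs normrM ger0_norm ?ler0n //.
apply: le_trans (hM n.+1); rewrite -mulrA mulrCA ler_wpM2l //.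
rewrite exprMn ler_pM ?ler0n ?exprn_ge0 //.
  by rewrite -natrX ler_nat ltnW // ltn_expl.
rewrite exprS; apply: (@le_trans _ _ ((K + 1) ^+ n)).
  by rewrite lerXn2r ?nnegrE ?addr_ge0 // lerDl.
by rewrite ler_peMl ?exprn_ge0 ?addr_ge0 // lerDr.
Qed.

Lemma entire_derive (R : realType) (c : R^nat) (x : R) :
  entire c ->
  is_derive x 1 (fun x => limn (pseries c x)) (limn (pseries (pseries_diffs c) x)).
Proof.
move=> hc; have hd := entire_diffs hc.
apply: (@pseries_snd_diffs _ c (`|x| + 1)); try exact: entire_cvg.
  exact/entire_cvg/entire_diffs.
by rewrite [ltRHS]ger0_norm ?addr_ge0 // ltrDl.
Qed.

(** Taylor coefficients at 0 of the solution of y'' = lam s y with y(0) = a and y'(0) = b; the third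
    one is 0 because y''(0) = 0. *)
Fixpoint airy_coef (R : realType) (lam a b : R) (n : nat) : R :=
  match n with
  | 0 => a
  | 1 => b
  | 2 => 0
  | (m.+2 as m2).+1 => lam * airy_coef lam a b m / (m2.+1%:R * m2%:R)
  end.

Lemma airy_coefE (R : realType) (lam a b : R) n :
  airy_coef lam a b n.+3 = lam * airy_coef lam a b n / (n.+3%:R * n.+2%:R).
Proof. by []. Qed.

(** Three steps of the recursion multiply |c n| K^n by |lam| K^3 / ((n+3)(n+2)), which is at most 1
    once n reaches [N]; the sum of the first [N.+3] terms therefore bounds them all. *)
Lemma entire_airy_coef (R : realType) (lam a b : R) : entire (airy_coef lam a b).
Proof.
move=> K K0; set c := airy_coef lam a b.
pose N := Num.bound (`|lam| * K ^+ 3).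
pose M := \sum_(i < N.+3) `|c i| * K ^+ i; exists M.
have c0 n : 0 <= `|c n| * K ^+ n by rewrite mulr_ge0 // exprn_ge0.
have base n : (n < N.+3)%N -> `|c n| * K ^+ n <= M.
  move=> nN; rewrite /M (bigD1 (Ordinal nN)) //= lerDl.
  by apply: sumr_ge0 => i _.
move=> n; have [m] := ubnP n; elim: m n => // m ih n nm.
have [/base//|Nn] := ltnP n N.+3.
case: n nm Nn => [|[|[|n]]] // nm Nn.
have {ih} : `|c n| * K ^+ n <= M by apply: ih; rewrite ltnS in nm; lia.
apply: le_trans; rewrite /c airy_coefE -/c normrM normfV normrM.
have p : 0 < n.+3%:R * n.+2%:R :> R by rewrite mulr_gt0 ?ltr0n.
rewrite (gtr0_norm p) mulrAC ler_pdivrMr // -[n.+3]/(3 + n)%N exprD.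
have -> : `|lam| * `|c n| * (K ^+ 3 * K ^+ n) =
   (`|c n| * K ^+ n) * (`|lam| * K ^+ 3) by ring.
apply: ler_wpM2l => //.
have -> : (3 + n = n.+3)%N by [].
have /ltW h : `|lam| * K ^+ 3 < N%:R.
  by rewrite /N; apply: archi_boundP; rewrite mulr_ge0 // exprn_ge0.
apply: (le_trans h); rewrite -natrM ler_nat.
have : (n.+3 <= n.+3 * n.+2)%N by rewrite leq_pmulr.
by move=> q; apply: leq_trans q; lia.
Qed.

Lemma airy_exists (R : realType) (lam a b : R) : exists y dy : R -> R,
  [/\ y 0 = a, dy 0 = b, forall s : R, is_derive s 1 y (dy s) &
      forall s : R, is_derive s 1 dy (lam * s * y s)].
Proof.
pose c := airy_coef lam a b; have hc : entire c by exact: entire_airy_coef.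
have hd := entire_diffs hc.
have at0 (d : R^nat) : limn (pseries d 0) = d 0%N.
  apply: cvg_lim => //; rewrite -cvg_shiftS.
  apply: cvg_near_cst; near=> n.
  rewrite /= /pseries /series /= big_nat_recl //= expr0 mulr1 big1 ?addr0 // => i _.
  by rewrite expr0n /= mulr0.
exists (fun s => limn (pseries c s)), (fun s => limn (pseries (pseries_diffs c) s)).
split=> [||s|s]; rewrite ?at0 //.
- by rewrite /pseries_diffs mul1r.
- exact: entire_derive.
have := entire_derive s hd; congr is_derive.
apply: cvg_lim => //.
(* The twice differentiated series has constant term 0; dropping it shifts the partial sums by one
   and leaves lam s times those of [c]. *)
rewrite -cvg_shiftS.
rewrite (_ : [sequence _]_n = (fun n => lam * s * pseries c s n)) //; last first.
  apply/funext=> n; rewrite /pseries /series /= big_nat_recl //.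
  rewrite /pseries_diffs mulr0 mulr0 mul0r add0r mulr_sumr.
  apply: eq_bigr => i _; rewrite /c airy_coefE exprS.
  by field; rewrite -!natrD !pnatr_eq0.
by apply: cvgMl_tmp; exact: entire_cvg.
Unshelve. all: by end_near. Qed.

(** * Fundamental solutions in the energy *)

Section derivation.
Variable R : realType.
Implicit Types (f g : R -> R) (t df dg : R).

Lemma eq_is_derive f df dg t : df = dg -> is_derive t 1 f df -> is_derive t 1 f dg.
Proof. by move=> ->. Qed.

Lemma is_derive_add f g df dg t : is_derive t 1 f df -> is_derive t 1 g dg ->
  is_derive t 1 (fun x => f x + g x) (df + dg).
Proof. by move=> hf hg; exact: (@is_deriveD _ _ _ f g _ _ _ _ hf hg). Qed.

Lemma is_derive_opp f df t :
  is_derive t 1 f df -> is_derive t 1 (fun x => - f x) (- df).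
Proof. by move=> hf; exact: (@is_deriveN _ _ _ f _ _ _ hf). Qed.

Lemma is_derive_sub f g df dg t : is_derive t 1 f df -> is_derive t 1 g dg ->
  is_derive t 1 (fun x => f x - g x) (df - dg).
Proof. by move=> hf hg; apply: is_derive_add => //; exact: is_derive_opp. Qed.

Lemma is_derive_mul f g df dg t : is_derive t 1 f df -> is_derive t 1 g dg ->
  is_derive t 1 (fun x => f x * g x) (df * g t + f t * dg).
Proof.
move=> hf hg; have := @is_deriveM _ _ f g _ _ _ _ hf hg.
by apply: eq_is_derive; rewrite /GRing.scale /= addrC mulrC.
Qed.

Lemma is_derive_scale (c : R) f df t :
  is_derive t 1 f df -> is_derive t 1 (fun x => c * f x) (c * df).
Proof. by move=> hf; exact: (@is_deriveZ _ _ _ f c _ _ _ hf). Qed.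

Lemma is_derive_affine (a b : R) f df t : is_derive (a * t + b) 1 f df ->
  is_derive t 1 (fun x => f (a * x + b)) (a * df).
Proof.
move=> hf; have -> : a * df = df * (a * 1 + 0) by ring.
apply: (@is_derive1_comp _ f (fun x => a * x + b) t df (a * 1 + 0) hf).
Qed.

Lemma is_derive_line (a b t : R) : is_derive t 1 (fun x => a + b * x) b.
Proof.
have := is_derive_add (is_derive_cst a t 1) (is_derive_scale b (is_derive_id t 1)).
by apply: eq_is_derive; ring.
Qed.

Lemma is_derive_continuous f df t : is_derive t 1 f df -> {for t, continuous f}.
Proof. by move=> [h _]; apply/differentiable_continuous/derivable1_diffP. Qed.

Lemma within_continuous f (a b : R) : (forall t, {for t, continuous f}) ->
  {within `[a, b], continuous f}.
Proof. exact: continuous_subspaceT. Qed.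

(** The derivative is required only inside the interval: eigenfunctions are controlled merely by
    continuity at the ends of the half cell. *)
Lemma constant_on f (a b : R) : {within `[a, b], continuous f} ->
  (forall t, t \in `]a, b[ -> is_derive t 1 f 0) -> {in `[a, b], forall t, f t = f a}.
Proof.
move=> cf df0 t; rewrite in_itv /= => /andP[a_t tb].
have [||c _] := @MVT_segment _ f (fun=> 0) a t a_t.
- move=> x; rewrite in_itv /= => /andP[ax xt]; apply: df0.
  by rewrite in_itv /= ax (lt_le_trans xt).
- apply: continuous_subspaceW cf.
  by move=> x; rewrite /= !in_itv /= => /andP[-> xt]; rewrite (le_trans xt).
by rewrite mul0r => /eqP; rewrite subr_eq0 => /eqP.
Qed.

End derivation.

(** Here |t| is replaced by t, which agrees with the potential on the half cell [0, 1] and keeps the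
    coefficient smooth on the whole line. *)
Definition schrodinger_at (R : realType) (lam e : R) (y dy : R -> R) (t : R) :=
  is_derive t 1 y (dy t) /\ is_derive t 1 dy (lam * (t - 1 - e) * y t).

Record fundamental (R : realType) (lam : R) (phi dphi psi dpsi : R -> R -> R) : Prop := {
  fund_phi : forall e t, schrodinger_at lam e (phi e) (dphi e) t;
  fund_psi : forall e t, schrodinger_at lam e (psi e) (dpsi e) t;
  fund_phi0 : forall e, phi e 0 = 1;
  fund_dphi0 : forall e, dphi e 0 = 0;
  fund_psi0 : forall e, psi e 0 = 0;
  fund_dpsi0 : forall e, dpsi e 0 = 1;
  fund_phi_cont : continuous (fun e => phi e 1);
  fund_dphi_cont : continuous (fun e => dphi e 1);
  fund_psi_cont : continuous (fun e => psi e 1);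
  fund_dpsi_cont : continuous (fun e => dpsi e 1) }.

(* With s = t - 1 - e the equation becomes y'' = lam s y, in which e no longer
   occurs: phi e and psi e are combinations of two fixed functions of s, and
   their continuity in e is free. *)
Lemma fundamental_exists (R : realType) (lam : R) :
  exists phi dphi psi dpsi : R -> R -> R, fundamental lam phi dphi psi dpsi.
Proof.
have [A [dA [A0 dA0 hA hdA]]] := airy_exists lam 1 0.
have [B [dB [B0 dB0 hB hdB]]] := airy_exists lam 0 1.
have W s : A s * dB s - dA s * B s = 1.
  pose w s := A s * dB s - dA s * B s.
  have -> : 1 = w 0 by rewrite /w A0 dA0 B0 dB0; ring.
  apply: (@is_derive_0_is_cst _ w) => x.
  have := is_derive_sub (is_derive_mul (hA x) (hdB x)) (is_derive_mul (hdA x) (hB x)).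
  by apply: eq_is_derive; ring.
have cA s : {for s, continuous A} by exact: is_derive_continuous (hA s).
have cdA s : {for s, continuous dA} by exact: is_derive_continuous (hdA s).
have cB s : {for s, continuous B} by exact: is_derive_continuous (hB s).
have cdB s : {for s, continuous dB} by exact: is_derive_continuous (hdB s).
have shift (f df : R -> R) (e : R) (t : R) : is_derive (t - 1 - e) 1 f (df (t - 1 - e)) ->
    is_derive t 1 (fun t => f (t - 1 - e)) (df (t - 1 - e)).
  move=> h; have := @is_derive_affine _ 1 (- 1 - e) f (df (t - 1 - e)) t.
  rewrite mul1r addrA => /(_ h); rewrite mul1r.
  by congr is_derive; apply/funext => x; congr f; ring.
pose sol a b := fun e t : R => a (-1 - e) * A (t - 1 - e) + b (-1 - e) * B (t - 1 - e) : R.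
pose dsol a b := fun e t : R => a (-1 - e) * dA (t - 1 - e) + b (-1 - e) * dB (t - 1 - e) : R.
have solP a b e t : schrodinger_at lam e (sol a b e) (dsol a b e) t.
  split.
    apply: (is_derive_add (is_derive_scale _ (shift A dA e t _))
      (is_derive_scale _ (shift B dB e t _))) => //.
  have := is_derive_add
    (is_derive_scale (a (-1 - e)) (shift dA (fun s => lam * s * A s) e t (hdA _)))
    (is_derive_scale (b (-1 - e)) (shift dB (fun s => lam * s * B s) e t (hdB _))).
  by apply: eq_is_derive; rewrite /sol; ring.
have cts (f : R -> R) (c : R) : (forall s, {for s, continuous f}) ->
    continuous (fun e => f (c - e)).
  move=> cf x; apply: (@continuous_comp _ _ _ (fun e => c - e) f); last exact: cf.
  by apply: cvgB; [exact: cvg_cst|exact: cvg_id].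
have contsol (a b u v : R -> R) :
    (forall s, {for s, continuous a}) -> (forall s, {for s, continuous b}) ->
    (forall s, {for s, continuous u}) -> (forall s, {for s, continuous v}) ->
    continuous (fun e : R => a (-1 - e) * u (1 - 1 - e) + b (-1 - e) * v (1 - 1 - e)).
  move=> ca cb cu cv x; apply: cvgD; apply: cvgM; exact: cts.
have cN (f : R -> R) : (forall s, {for s, continuous f}) ->
    forall s, {for s, continuous (fun s => - f s)}.
  by move=> cf s; apply: cvgN; exact: cf.
(* Since the Wronskian of [A] and [B] is 1, these coefficients, taken at s = -1 - e (that is, t =
   0), solve the linear systems for the Cauchy data (1, 0) and (0, 1). *)
exists (sol dB (fun s => - dA s)), (dsol dB (fun s => - dA s)),
  (sol (fun s => - B s) A), (dsol (fun s => - B s) A).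
split=> // [e|e|e|e||||].
- by rewrite /sol sub0r; apply: etrans (W (-1 - e)); ring.
- by rewrite /dsol sub0r; ring.
- by rewrite /sol sub0r; ring.
- by rewrite /dsol sub0r; apply: etrans (W (-1 - e)); ring.
- exact: (contsol dB (fun s => - dA s) A B cdB (cN _ cdA) cA cB).
- exact: (contsol dB (fun s => - dA s) dA dB cdB (cN _ cdA) cdA cdB).
- exact: (contsol (fun s => - B s) A A B (cN _ cB) cA cA cB).
- exact: (contsol (fun s => - B s) A dA dB (cN _ cB) cA cdA cdB).
Qed.

(** * Wronskian identities and representation of solutions *)

Section fundamental_theory.
Variables (R : realType) (lam : R) (phi dphi psi dpsi : R -> R -> R).
Hypothesis F : fundamental lam phi dphi psi dpsi.

(** The Wronskians of [y] with [phi e] and [psi e] are constant; comparing their values at 0 and [t]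
    recovers the Cauchy data. In particular a solution with [y] and [dy] both zero at one point has
    zero data. *)
Lemma fundamental_init (e : R) y dy :
  {within `[(0 : R), 1], continuous y} -> {within `[(0 : R), 1], continuous dy} ->
  {in `](0 : R), 1[, forall t, schrodinger_at lam e y dy t} ->
  {in `[(0 : R), 1], forall t, y 0 = y t * dpsi e t - dy t * psi e t /\
    dy 0 = dy t * phi e t - y t * dphi e t}.
Proof.
move=> cy cdy hy t t01.
have wronsk z dz : (forall t : R, schrodinger_at lam e z dz t) ->
    y t * dz t - dy t * z t = y 0 * dz 0 - dy 0 * z 0.
  move=> hz.
  apply: (@constant_on _ (fun t => y t * dz t - dy t * z t) 0 1) => // [|x x01].
    have cz : {within `[(0 : R), 1], continuous z}.
      by apply: within_continuous => x; exact: is_derive_continuous (hz x).1.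
    have cdz : {within `[(0 : R), 1], continuous dz}.
      by apply: within_continuous => x; exact: is_derive_continuous (hz x).2.
    by move=> x; apply: cvgB; apply: cvgM; [exact: cy|exact: cdz|exact: cdy|exact: cz].
  have [y1 y2] := hy _ x01; have [z1 z2] := hz x.
  have := is_derive_sub (is_derive_mul y1 z2) (is_derive_mul y2 z1).
  by apply: eq_is_derive; ring.
have := wronsk _ _ (fund_phi F e); have := wronsk _ _ (fund_psi F e).
rewrite (fund_phi0 F) (fund_dpsi0 F) (fund_dphi0 F) (fund_psi0 F) => E1 E2.
by split; [rewrite E1|rewrite -(opprB (y t * _)) E2]; ring.
Qed.

Lemma fundamental_repr (e : R) y dy :
  {within `[(0 : R), 1], continuous y} -> {within `[(0 : R), 1], continuous dy} ->
  {in `](0 : R), 1[, forall t, schrodinger_at lam e y dy t} ->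
  {in `[(0 : R), 1], forall t, y t = y 0 * phi e t + dy 0 * psi e t /\
    dy t = y 0 * dphi e t + dy 0 * dpsi e t}.
Proof.
move=> cy cdy hy t t01; have [E1 E2] := fundamental_init cy cdy hy t01.
have W1 : phi e t * dpsi e t - dphi e t * psi e t = 1.
  pose w x := phi e x * dpsi e x - dphi e x * psi e x.
  have -> : 1 = w 0.
    by rewrite /w (fund_phi0 F) (fund_dpsi0 F) (fund_dphi0 F) (fund_psi0 F); ring.
  apply: (@is_derive_0_is_cst _ w) => x.
  have [y1 y2] := fund_phi F e x; have [z1 z2] := fund_psi F e x.
  have := is_derive_sub (is_derive_mul y1 z2) (is_derive_mul y2 z1).
  by apply: eq_is_derive; ring.
(* Multiplying by the Wronskian [W1] turns the inversion of the linear system into a polynomial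
   identity. *)
by rewrite E1 E2; split; rewrite -[LHS]mulr1 -W1; ring.
Qed.

(* (y y')' = y'^2 + lam (t - 1 - e) y^2, so both terms vanish at some point. *)
Lemma schrodinger_above_bottom (e : R) y dy : 0 < lam -> e <= -1 ->
  (forall t, schrodinger_at lam e y dy t) ->
  y 0 * dy 0 = 0 -> y 1 * dy 1 = 0 -> y 0 = 0 /\ dy 0 = 0.
Proof.
move=> lam0 em1 hy h0 h1.
have cy : {within `[(0 : R), 1], continuous y}.
  by apply: within_continuous => x; exact: is_derive_continuous (hy x).1.
have cdy : {within `[(0 : R), 1], continuous dy}.
  by apply: within_continuous => x; exact: is_derive_continuous (hy x).2.
have [||c c01] := @MVT _ (fun t => y t * dy t)
  (fun t => dy t * dy t + y t * (lam * (t - 1 - e) * y t)) 0 1 ltr01.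
- by move=> x _; have [] := hy x; exact: is_derive_mul.
- by move=> x; apply: cvgM; [exact: cy|exact: cdy].
move: (c01); rewrite in_itv /= => /andP[c0 c1].
rewrite h0 h1 subrr subr0 mulr1 => /esym E.
(* The mean value point is interior, so c - 1 - e >= c > 0 even at e = -1. *)
have q0 : 0 < lam * (c - 1 - e) by apply: mulr_gt0 => //; lra.
have dyc : dy c = 0.
  by apply/eqP; rewrite -sqrf_eq0; apply/eqP; nra.
have yc : y c = 0.
  by apply/eqP; rewrite -sqrf_eq0; apply/eqP; nra.
have c01' : c \in `[0, 1] by rewrite in_itv /= !ltW.
have [-> ->] := fundamental_init cy cdy (fun t _ => hy t) c01'.
by rewrite dyc yc; split; ring.
Qed.

End fundamental_theory.

(** * Estimates for small coupling *)

Section estimates.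
Variable R : realType.
Implicit Types (f df ddf y dy : R -> R) (lam e Q C t : R).

Lemma increment_bound f df C : (forall t, is_derive t 1 f (df t)) ->
  {in `[0, 1], forall t, `|df t| <= C} -> {in `[0, 1], forall t, `|f t - f 0| <= C}.
Proof.
move=> hf hdf t; rewrite in_itv /= => /andP[t0 t1].
have cf : {within `[0, t], continuous f}.
  by apply: within_continuous => x; exact: is_derive_continuous (hf x).
have [c] := MVT_segment t0 (fun x _ => hf x) cf.
rewrite in_itv /= subr0 => /andP[c0 ct] ->; rewrite normrM (ger0_norm t0).
have : `|df c| <= C by apply: hdf; rewrite in_itv /= c0 (le_trans ct).
have := normr_ge0 (df c); nra.
Qed.

(** Each of the two integrations runs over a length at most 1, so the constant [C] survives both. *)
Lemma second_order_bound f df ddf C : (forall t, is_derive t 1 f (df t)) ->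
  (forall t, is_derive t 1 df (ddf t)) -> f 0 = 0 -> df 0 = 0 ->
  {in `[0, 1], forall t, `|ddf t| <= C} ->
  {in `[0, 1], forall t, `|f t| <= C /\ `|df t| <= C}.
Proof.
move=> hf hdf f0 df0 hC.
have h1 : {in `[0, 1], forall t, `|df t| <= C}.
  by move=> t t01; rewrite -[df t]subr0 -df0; exact: increment_bound hdf hC _ t01.
move=> t t01; split; last exact: h1.
by rewrite -[f t]subr0 -f0; exact: increment_bound hf h1 _ t01.
Qed.

(** Comparison with the affine solution of y'' = 0 having the same data. The maximum M of |y|
    satisfies M <= Q M + 1, hence M <= 3/2 when Q <= 1/3, and then |y''| <= 3/2 Q. *)
Lemma schrodinger_free_bound lam e Q y dy :
  (forall t, schrodinger_at lam e y dy t) -> `|y 0| + `|dy 0| <= 1 -> Q <= 1 / 3 ->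
  {in `[0, 1], forall t, `|lam * (t - 1 - e)| <= Q} ->
  {in `[0, 1], forall t, `|y t - (y 0 + dy 0 * t)| <= 3 / 2 * Q /\
    `|dy t - dy 0| <= 3 / 2 * Q}.
Proof.
move=> hy h0 Q3 hQ.
have [c c01 hc] : exists2 c, c \in `[0, 1] & forall t, t \in `[0, 1] -> `|y t| <= `|y c|.
  apply: (@EVT_max _ (fun t => `|y t|)) => // x.
  apply: cvg_norm; apply: within_continuous => x'; exact: is_derive_continuous (hy x').1.
set M := `|y c| in hc.
have Q0 : 0 <= Q.
  have zero01 : (0 : R) \in `[0, 1] by rewrite in_itv /= lexx ler01.
  by apply: le_trans (normr_ge0 _) (hQ 0 zero01).
have M0 : 0 <= M by exact: normr_ge0.
have hr : {in `[0, 1], forall t, `|y t - (y 0 + dy 0 * t)| <= Q * M /\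
    `|dy t - dy 0| <= Q * M}.
  apply: (@second_order_bound (fun t => y t - (y 0 + dy 0 * t)) (fun t => dy t - dy 0)
    (fun t => lam * (t - 1 - e) * y t)).
  - move=> t; have [h _] := hy t; apply: is_derive_sub => //.
    exact: is_derive_line.
  - move=> t; have [_ h] := hy t.
    by apply: eq_is_derive (is_derive_sub h (is_derive_cst (dy 0) t 1)); rewrite subr0.
  - ring.
  - ring.
  - by move=> t t01; rewrite normrM ler_pM // ?hQ ?hc.
have M32 : M <= 3 / 2.
  have [h _] := hr _ c01.
  have : M <= Q * M + (`|y 0| + `|dy 0|).
    apply: (@le_trans _ _ (`|y c - (y 0 + dy 0 * c)| + `|y 0 + dy 0 * c|)).
      by rewrite /M -{1}[y c](subrK (y 0 + dy 0 * c)) ler_normD.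
    apply: lerD => //; apply: le_trans (ler_normD _ _) _.
    rewrite lerD2l normrM ler_piMr //.
    by move: c01; rewrite in_itv /= => /andP[c0 c1]; rewrite ger0_norm.
  nra.
move=> t t01; have [h1 h2] := hr _ t01.
by split; [apply: le_trans h1 _|apply: le_trans h2 _]; rewrite mulrC ler_wpM2r.
Qed.

(** The two thresholds are chosen so that |lam (t - 1 - e)| <= 1/12 + 1/4 = 1/3; both quantities
    then stay within 1/2 of their free value 1. *)
Lemma fundamental_positive lam e phi dphi psi dpsi : 0 < lam <= 1 / 12 ->
  -1 <= e <= 1 / (4 * lam) -> fundamental lam phi dphi psi dpsi ->
  0 < phi e 1 /\ 0 < dpsi e 1.
Proof.
move=> /andP[lam0 lam12] /andP[e1 e2] F.
have le4 : lam * e <= 1 / 4.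
  by move: e2; rewrite ler_pdivlMr ?mulr_gt0 // => ?; nra.
have hQ : {in `[0, 1], forall t, `|lam * (t - 1 - e)| <= 1 / 3}.
  move=> t; rewrite in_itv /= => /andP[t0 t1].
  by rewrite ler_norml; apply/andP; split; nra.
have one01 : (1 : R) \in `[0, 1] by rewrite in_itv /= lexx ler01.
have h1 : `|phi e 0| + `|dphi e 0| <= 1.
  by rewrite (fund_phi0 F) (fund_dphi0 F) normr1 normr0 addr0.
have h2 : `|psi e 0| + `|dpsi e 0| <= 1.
  by rewrite (fund_psi0 F) (fund_dpsi0 F) normr1 normr0 add0r.
have [+ _] := schrodinger_free_bound (fund_phi F e) h1 (lexx _) hQ one01.
have [_] := schrodinger_free_bound (fund_psi F e) h2 (lexx _) hQ one01.
rewrite (fund_phi0 F) (fund_dphi0 F) (fund_dpsi0 F) !ler_norml.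
by move=> /andP[? _] /andP[? _]; split; lra.
Qed.

(* The coefficients of phi e = 1 + lam p1 + lam^2 p2 + O(lam^3) solve
   p1'' = s - (1 + e), p2'' = (s - (1 + e)) p1. *)
Lemma dphi_expansion lam e phi dphi psi dpsi : 0 < lam <= 1 / 3 ->
  -1 <= e <= 0 -> fundamental lam phi dphi psi dpsi ->
  let a := 1 + e in
  `|dphi e 1 - (lam * (1 / 2 - a) + lam ^+ 2 * (1 / 30 - a * (1 - a) / 6))|
    <= 3 / 2 * lam ^+ 3 /\ 0 < psi e 1.
Proof.
move=> /andP[lam0 lam3] /andP[e1 e2] F a.
have hQ : {in `[0, 1], forall t, `|lam * (t - 1 - e)| <= lam}.
  move=> t; rewrite in_itv /= => /andP[t0 t1].
  by rewrite ler_norml; apply/andP; split; nra.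
have one01 : (1 : R) \in `[0, 1] by rewrite in_itv /= lexx ler01.
have h1 : `|phi e 0| + `|dphi e 0| <= 1.
  by rewrite (fund_phi0 F) (fund_dphi0 F) normr1 normr0 addr0.
have h2 : `|psi e 0| + `|dpsi e 0| <= 1.
  by rewrite (fund_psi0 F) (fund_dpsi0 F) normr1 normr0 add0r.
split; last first.
  have [+ _] := schrodinger_free_bound (fund_psi F e) h2 lam3 hQ one01.
  rewrite (fund_psi0 F) (fund_dpsi0 F) ler_norml => /andP[? _]; lra.
have b0 := schrodinger_free_bound (fund_phi F e) h1 lam3 hQ.
rewrite (fund_phi0 F) (fund_dphi0 F) in b0.
pose p1 t := 6^-1 * t ^+ 3 - a / 2 * t ^+ 2.
pose dp1 t := 2^-1 * t ^+ 2 - a * t ^+ 1.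
pose p2 t := 180^-1 * t ^+ 6 - a / 30 * t ^+ 5 + a ^+ 2 / 24 * t ^+ 4.
pose dp2 t := 30^-1 * t ^+ 5 - a / 6 * t ^+ 4 + a ^+ 2 / 6 * t ^+ 3.
have powD n t : is_derive t 1 (fun x : R => x ^+ n.+1) (n.+1%:R * t ^+ n).
  have := @is_deriveX _ _ id n.+1 t 1 _ (is_derive_id t 1); rewrite exprfctE.
  by apply: eq_is_derive; rewrite /GRing.scale /= mulr1.
have mono c n t : is_derive t 1 (fun x : R => c * x ^+ n.+1) (c * (n.+1%:R * t ^+ n)).
  by apply: is_derive_scale; exact: powD.
have Dp1 t : is_derive t 1 p1 (dp1 t).
  by apply: eq_is_derive (is_derive_sub (mono 6^-1 2 t) (mono (a / 2) 1 t)); rewrite /dp1; field.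
have Ddp1 t : is_derive t 1 dp1 (t - a).
  by apply: eq_is_derive (is_derive_sub (mono 2^-1 1 t) (mono a 0 t)); field.
have Dp2 t : is_derive t 1 p2 (dp2 t).
  by apply: eq_is_derive (is_derive_add (is_derive_sub (mono 180^-1 5 t) (mono (a / 30) 4 t))
    (mono (a ^+ 2 / 24) 3 t)); rewrite /dp2; field.
have Ddp2 t : is_derive t 1 dp2 ((t - a) * p1 t).
  by apply: eq_is_derive (is_derive_add (is_derive_sub (mono 30^-1 4 t) (mono (a / 6) 3 t))
    (mono (a ^+ 2 / 6) 2 t)); rewrite /p1; field.
(* Picard iteration: the second derivative of each remainder is lam (t - 1 - e) times the previous
   remainder, which gains a factor lam. The same step gives [b2] from [b1]. *)
have b1 : {in `[0, 1], forall t, `|phi e t - 1 - lam * p1 t| <= 3 / 2 * lam ^+ 2 /\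
    `|dphi e t - lam * dp1 t| <= 3 / 2 * lam ^+ 2}.
  apply: (@second_order_bound (fun t => phi e t - 1 - lam * p1 t)
    (fun t => dphi e t - lam * dp1 t) (fun t => lam * (t - 1 - e) * (phi e t - 1))).
  - move=> t; have [h _] := fund_phi F e t.
    have := is_derive_sub (is_derive_sub h (is_derive_cst (1 : R) t 1))
      (is_derive_scale lam (Dp1 t)).
    by apply: eq_is_derive; ring.
  - move=> t; have [_ h] := fund_phi F e t.
    have := is_derive_sub h (is_derive_scale lam (Ddp1 t)).
    by apply: eq_is_derive; rewrite /a; ring.
  - by rewrite (fund_phi0 F) /p1; ring.
  - by rewrite (fund_dphi0 F) /dp1; ring.
  - move=> t t01; have [+ _] := b0 _ t01; rewrite mul0r addr0 => hb.
    by rewrite normrM expr2 mulrCA ler_pM // hQ.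
have b2 : {in `[0, 1], forall t,
    `|phi e t - 1 - lam * p1 t - lam ^+ 2 * p2 t| <= 3 / 2 * lam ^+ 3 /\
    `|dphi e t - lam * dp1 t - lam ^+ 2 * dp2 t| <= 3 / 2 * lam ^+ 3}.
  apply: (@second_order_bound (fun t => phi e t - 1 - lam * p1 t - lam ^+ 2 * p2 t)
    (fun t => dphi e t - lam * dp1 t - lam ^+ 2 * dp2 t)
    (fun t => lam * (t - 1 - e) * (phi e t - 1 - lam * p1 t))).
  - move=> t; have [h _] := fund_phi F e t.
    have := is_derive_sub (is_derive_sub (is_derive_sub h (is_derive_cst (1 : R) t 1))
      (is_derive_scale lam (Dp1 t))) (is_derive_scale (lam ^+ 2) (Dp2 t)).
    by apply: eq_is_derive; ring.
  - move=> t; have [_ h] := fund_phi F e t.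
    have := is_derive_sub (is_derive_sub h (is_derive_scale lam (Ddp1 t)))
      (is_derive_scale (lam ^+ 2) (Ddp2 t)).
    by apply: eq_is_derive; rewrite /a; ring.
  - by rewrite (fund_phi0 F) /p1 /p2; ring.
  - by rewrite (fund_dphi0 F) /dp1 /dp2; ring.
  - move=> t t01; have [hb _] := b1 _ t01.
    by rewrite normrM exprS mulrCA ler_pM // hQ.
have [_] := b2 _ one01; congr (`|_| <= _).
by rewrite /dp1 /dp2; field.
Qed.

(* At lam e = pi^2 compare phi e with cos (pi t): the energy
   p = r'^2 + pi^2 r^2 of the difference r has |p'| <= lam (2 p + 1). *)
Lemma phi_neg lam phi dphi psi dpsi : 0 < lam <= 1 / 12 ->
  fundamental lam phi dphi psi dpsi -> phi (pi ^+ 2 / lam) 1 < 0.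
Proof.
move=> /andP[lam0 lam12] F; set e := _ / lam.
have lame : lam * e = pi ^+ 2 by rewrite mulrC divfK ?gt_eqF.
have one01 : (1 : R) \in `[0, 1] by rewrite in_itv /= lexx ler01.
pose c t : R := cos (pi * t + 0).
pose s t : R := sin (pi * t + 0).
have Dc t : is_derive t 1 c (- (pi * s t)).
  by have := is_derive_affine (is_derive_cos (pi * t + 0)); rewrite mulrN.
have Ds t : is_derive t 1 s (pi * c t).
  exact: (is_derive_affine (is_derive_sin (pi * t + 0))).
pose r t := phi e t - c t.
pose dr t := dphi e t + pi * s t.
pose q t := lam * (t - 1) * phi e t.
have Dr t : is_derive t 1 r (dr t).
  have [h _] := fund_phi F e t.
  by have := is_derive_sub h (Dc t); apply: eq_is_derive; rewrite opprK.
have Ddr t : is_derive t 1 dr (q t - pi ^+ 2 * r t).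
  have [_ h] := fund_phi F e t.
  have := is_derive_add h (is_derive_scale pi (Ds t)); apply: eq_is_derive.
  rewrite mulrBr lame /q /r; ring.
pose p t := dr t * dr t + pi ^+ 2 * (r t * r t).
pose dp t := 2 * dr t * q t.
have Dp t : is_derive t 1 p (dp t).
  have := is_derive_add (is_derive_mul (Ddr t) (Ddr t))
    (is_derive_scale (pi ^+ 2) (is_derive_mul (Dr t) (Dr t))).
  by apply: eq_is_derive; rewrite /dp; ring.
have p0 : p 0 = 0.
  rewrite /p /dr /r /c /s mulr0 addr0 sin0 cos0 (fund_phi0 F) (fund_dphi0 F); ring.
have rp t : r t ^+ 2 + dr t ^+ 2 <= p t.
  have : 1 <= pi ^+ 2 :> R by have := pi_ge2 R; nra.
  by rewrite /p; nra.
have [x x01 hx] : exists2 x, x \in `[0, 1] & forall t, t \in `[0, 1] -> p t <= p x.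
  apply: EVT_max => //.
  by apply: within_continuous => x; exact: is_derive_continuous (Dp x).
have hdp : {in `[0, 1], forall t, `|dp t| <= lam * (2 * p x + 1)}.
  move=> t t01; have := hx _ t01; have := rp t => h1 h2.
  have c1 : -1 <= c t <= 1 by rewrite cos_geN1 cos_le1.
  have -> : dp t = lam * (2 * dr t * ((t - 1) * (r t + c t))) by rewrite /dp /q /r; ring.
  rewrite normrM (gtr0_norm lam0) ler_wpM2l ?(ltW lam0) //.
  rewrite -mulrA normrM ger0_norm // normrM normrM.
  have t1 : `|t - 1| <= 1.
    by move: t01; rewrite in_itv /= => /andP[? ?]; rewrite ler_norml; apply/andP; split; lra.
  have rc : `|r t + c t| <= `|r t| + 1.
    by apply: le_trans (ler_normD _ _) _; rewrite lerD2l ler_norml.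
  have : `|t - 1| * `|r t + c t| <= `|r t| + 1.
    by rewrite -[leRHS]mul1r ler_pM.
  have := normr_ge0 (dr t); have := normr_ge0 (r t).
  have := real_normK (num_real (dr t)); have := real_normK (num_real (r t)).
  (* From these squares, 2 |dr| (|r| + 1) <= 2 dr^2 + r^2 + 1 <= 2 p + 1. *)
  have : 0 <= (`|dr t| - `|r t|) ^+ 2 by rewrite sqr_ge0.
  have : 0 <= (`|dr t| - 1) ^+ 2 by rewrite sqr_ge0.
  nra.
have hp := increment_bound Dp hdp.
have px : p x <= lam * (2 * p x + 1).
  by have := hp _ x01; rewrite p0 subr0; apply: le_trans; exact: ler_norm.
(* With lam <= 1/12, [px] forces p x <= 1/10. As cos pi = -1, |r 1| < 1 makes phi negative at 1. *)
have r1 : r 1 ^+ 2 < 1.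
  have := hx _ one01; have := rp 1; have := sqr_ge0 (dr 1).
  have : 0 <= p x by apply: le_trans (rp x); rewrite addr_ge0 ?sqr_ge0.
  nra.
have : r 1 = phi e 1 + 1 by rewrite /r /c mulr1 addr0 cospi opprK.
nra.
Qed.

End estimates.

(** * Least eigenvalues in dimensionless form *)

(** The zeros in [b, z] form a nonempty compact set, on which the identity attains its minimum; all
    other zeros lie above z. *)
Lemma least_zero (R : realType) (D : R -> R) (b z : R) : continuous D ->
  D z = 0 -> (forall e, e <= b -> D e != 0) ->
  exists e0, D e0 = 0 /\ forall e, D e = 0 -> e0 <= e.
Proof.
move=> cD Dz Db.
have cZ : closed (D @^-1` [set 0]).
  by apply: closed_comp => [x _|]; [exact: cD|exact: closed_eq].
have cK : compact (`[b, z] `&` D @^-1` [set 0]).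
  by apply: compact_closedI => //; exact: segment_compact.
have inK e : D e = 0 -> e <= z -> e \in (`[b, z] `&` D @^-1` [set 0]).
  move=> De ez; rewrite inE; split => //=.
  rewrite in_itv /= ez andbT leNgt; apply/negP => /ltW /Db.
  by rewrite De eqxx.
have K0 : (`[b, z] `&` D @^-1` [set 0]) !=set0.
  by exists z; have := inK z Dz (lexx _); rewrite inE.
have cid : {within `[b, z] `&` D @^-1` [set 0], continuous (@id R)}.
  by apply: continuous_subspaceT => x; exact: cvg_id.
have [e0] := compact_EVT_min K0 cK cid.
rewrite inE => -[e0z De0] he0; exists e0; split => // e De.
have [ez|/ltW ze] := leP e z; first exact/he0/inK.
apply: le_trans ze.
by move: e0z; rewrite /= in_itv /= => /andP[].
Qed.

Section dimensionless_spectrum.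
Variables (R : realType) (lam : R) (phi dphi psi dpsi : R -> R -> R).
Hypothesis F : fundamental lam phi dphi psi dpsi.
Hypothesis lam_small : 0 < lam <= 1 / 12.

Let lam_gt0 : 0 < lam. Proof. by case/andP: lam_small. Qed.

(** All four boundary values are thus nonzero at or below the bottom of the potential, which rules
    out zeros of both secular products there. *)
Lemma boundary_neq0 (e : R) : e <= -1 -> phi e 1 * dphi e 1 != 0 /\ psi e 1 * dpsi e 1 != 0.
Proof.
move=> e1; split; apply/eqP => h.
  have [] := schrodinger_above_bottom F lam_gt0 e1 (fund_phi F e) _ h.
    by rewrite (fund_dphi0 F) mulr0.
  by rewrite (fund_phi0 F) => /eqP; rewrite oner_eq0.
have [] := schrodinger_above_bottom F lam_gt0 e1 (fund_psi F e) _ h.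
  by rewrite (fund_psi0 F) mul0r.
by rewrite (fund_dpsi0 F) => _ /eqP; rewrite oner_eq0.
Qed.

(** The leading term - lam (e + 1/2) makes [dphi] change sign between e = -1 and e = 0, and psi is
    positive at 1 there, so the least zero of the product is one of [dphi]; the expansion then
    locates it. *)
Lemma periodic_least : exists e0, [/\ dphi e0 1 = 0,
  forall e, dphi e 1 * psi e 1 = 0 -> e0 <= e &
  `|e0 - (- (1 / 2) - lam / 120)| <= 2 * lam ^+ 2].
Proof.
have [_ lam12] := andP lam_small; have lam0 := lam_gt0.
have lam3 : 0 < lam <= 1 / 3 by apply/andP; split; lra.
have dphi_m1 : 0 < dphi (-1) 1.
  have I : -1 <= (-1 : R) <= 0 by apply/andP; split; lra.
  have [+ _] := dphi_expansion lam3 I F.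
  rewrite ler_norml => /andP[+ _]; nra.
have dphi_0 : dphi 0 1 < 0.
  have I : -1 <= (0 : R) <= 0 by apply/andP; split; lra.
  have [+ _] := dphi_expansion lam3 I F.
  rewrite ler_norml => /andP[_]; nra.
have [z z01 hz] : exists2 z, z \in `[(-1 : R), 0] & dphi z 1 = 0.
  apply: (@IVT _ (fun e => dphi e 1)) => //.
    by apply: continuous_subspaceT; exact: (fund_dphi_cont F).
  by rewrite ge_min le_max (ltW dphi_0) (ltW dphi_m1) orbT.
have [|||e0 [he0 least0]] := @least_zero _ (fun e => dphi e 1 * psi e 1) (-1) z.
- by move=> x; apply: cvgM; [exact: (fund_dphi_cont F)|exact: (fund_psi_cont F)].
- by rewrite hz mul0r.
- move=> e /boundary_neq0[+ +]; rewrite !mulf_eq0 !negb_or.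
  by move=> /andP[_ ->] /andP[-> _].
have e0I : -1 <= e0 <= 0.
  move: z01; rewrite in_itv /= => /andP[_ z0].
  have e0z : e0 <= z by apply: least0; rewrite hz mul0r.
  rewrite (le_trans e0z z0) andbT leNgt; apply/negP => /ltW /boundary_neq0[+ +].
  rewrite !mulf_eq0 !negb_or => /andP[_ h1] /andP[h2 _].
  by move/eqP: he0; rewrite mulf_eq0 (negbTE h1) (negbTE h2).
have [hexp psi0] := dphi_expansion lam3 e0I F.
have dphi0 : dphi e0 1 = 0.
  by move/eqP: he0; rewrite mulf_eq0 (gt_eqF psi0) orbF => /eqP.
exists e0; split=> //; move: hexp; rewrite dphi0.
move: e0I => /andP[e1 e2].
pose b := e0 + 1 / 2.
have -> : 0 - (lam * (1 / 2 - (1 + e0)) + lam ^+ 2 * (1 / 30 - (1 + e0) * (1 - (1 + e0)) / 6)) =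
  lam * (b + lam / 120 - lam * b ^+ 2 / 6) by rewrite /b; field.
rewrite normrM (gtr0_norm lam0) -ler_pdivlMl // => hb.
have {}hb : `|b + lam / 120 - lam * b ^+ 2 / 6| <= 3 / 2 * lam ^+ 2.
  have e3 : 3 / 2 * lam ^+ 2 = lam^-1 * (3 / 2 * lam ^+ 3) by field; rewrite gt_eqF.
  by rewrite e3.
have -> : e0 - (- (1 / 2) - lam / 120) = b + lam / 120 by rewrite /b; ring.
move: hb; rewrite !ler_norml => /andP[h1 h2].
have bI : -(1 / 2) <= b <= 1 / 2 by rewrite /b; apply/andP; split; lra.
have b2 : 0 <= b ^+ 2 <= 1 / 4 by move: bI => /andP[? ?]; apply/andP; split; nra.
(* Bootstrap: the crude b^2 <= 1/4 first gives |b| <= lam, after which lam b^2 / 6 is of order lam^2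
   and 3/2 + 1/6 <= 2. *)
have bl : - lam <= b <= lam.
  by move: b2 => /andP[? ?]; apply/andP; split; nra.
have b2' : b ^+ 2 <= lam ^+ 2 by move: bl => /andP[? ?]; nra.
have b2'' : lam * b ^+ 2 <= lam ^+ 2 by move: bl b2 => /andP[? ?] /andP[? ?]; nra.
have : 0 <= lam * b ^+ 2 by rewrite mulr_ge0 ?sqr_ge0 // ltW.
by move=> ?; apply/andP; split; nra.
Qed.

(** A zero exists because phi at 1 changes sign between 1 / (4 lam) and pi^2 / lam. Up to 1 / (4
    lam) there is none: [boundary_neq0] covers e < -1, [fundamental_positive] the rest. *)
Lemma antiperiodic_least : exists e0, [/\ phi e0 1 * dpsi e0 1 = 0,
  forall e, phi e 1 * dpsi e 1 = 0 -> e0 <= e & 1 / (4 * lam) <= e0].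
Proof.
have neq0 e : e <= 1 / (4 * lam) -> phi e 1 * dpsi e 1 != 0.
  move=> he; have [e1|/ltW e1] := leP e (-1).
    have [+ +] := boundary_neq0 e1; rewrite !mulf_eq0 !negb_or.
    by move=> /andP[-> _] /andP[_ ->].
  have [|p1 p2] := fundamental_positive lam_small _ F (e := e); first by rewrite e1.
  by rewrite mulf_neq0 ?gt_eqF.
have hneg := phi_neg lam_small F.
have hle : 1 / (4 * lam) <= pi ^+ 2 / lam.
  rewrite invfM mulrA ler_wpM2r ?invr_ge0 ?ltW //.
  have := pi_ge2 R; nra.
have hpos : 0 < phi (1 / (4 * lam)) 1.
  have [|//] := fundamental_positive lam_small _ F (e := 1 / (4 * lam)).
  rewrite lexx andbT; apply: (@le_trans _ _ 0); first by lra.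
  by rewrite divr_ge0 // mulr_ge0 // ltW.
have [z _ hz] : exists2 z, z \in `[(1 / (4 * lam)), pi ^+ 2 / lam] & phi z 1 = 0.
  apply: (@IVT _ (fun e => phi e 1)) => //.
    by apply: continuous_subspaceT; exact: (fund_phi_cont F).
  by rewrite ge_min le_max (ltW hneg) (ltW hpos) orbT.
have [|||e0 [he0 least0]] :=
  @least_zero _ (fun e => phi e 1 * dpsi e 1) (1 / (4 * lam)) z.
- by move=> x; apply: cvgM; [exact: (fund_phi_cont F)|exact: (fund_dpsi_cont F)].
- by rewrite hz mul0r.
- exact: neq0.
exists e0; split=> //.
rewrite leNgt; apply/negP => /ltW /neq0; by rewrite he0 eqxx.
Qed.

End dimensionless_spectrum.

(** * Regularity of eigenfunctions *)

Section regularity.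
Variable R : realType.
Notation mu := (@lebesgue_measure R).
Implicit Types (a b x : R) (f F u du ddu c : R -> R).

Lemma primitive_continuous a b F f : a < b ->
  mu.-integrable `[a, b] (EFin \o f) ->
  {in `[a, b], forall x, F x = F a + \int[mu]_(t in `[a, x]) f t} ->
  {within `[a, b], continuous F}.
Proof.
move=> ab fi hF; have cG := parameterized_integral_continuous (ltW ab) fi.
apply: (@subspace_eq_continuous _ _ _ (fun x => F a + parameterized_integral mu a x f)).
  by move=> x; rewrite inE /= => xab; rewrite /from_subspace (hF _ xab).
by move=> x; apply: cvgD; [exact: cvg_cst|exact: cG].
Qed.

Lemma primitive_derive a b F f : a < b ->
  {within `[a, b], continuous f} ->
  {in `[a, b], forall x, F x = F a + \int[mu]_(t in `[a, x]) f t} ->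
  {in `]a, b[, forall x, is_derive x 1 F (f x)}.
Proof.
move=> ab cf hF x xab; have [ax xb] : a < x /\ x < b.
  by move: xab; rewrite in_itv /= => /andP[].
have fi : mu.-integrable `[a, b] (EFin \o f).
  by apply: continuous_compact_integrable => //; exact: segment_compact.
have [cfi _ _] := (continuous_within_itvP f ab).1 cf.
have [d1 d2] := continuous_FTC1_closed xb fi ax (cfi _ xab).
have D0 : is_derive x 1 (fun x => \int[mu]_(t in `[a, x]) f t) (f x).
  by split; [exact: d1|rewrite -derive1E; exact: d2].
have D := is_derive_add (is_derive_cst (F a) x 1) D0.
rewrite add0r in D; apply: near_eq_is_derive D.
near=> y; rewrite [RHS]hF // in_itv /=; apply/andP; split; apply: ltW; near: y.
  exact: lt_nbhsr.
exact: lt_nbhsl.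
Unshelve. all: by end_near. Qed.

(** Since |ddu| <= 1 + ddu^2, [ddu] is integrable, so [du] and then [u] are continuous. As [ddu]
    equals the continuous c u almost everywhere, [du] is also a primitive of c u, and the
    fundamental theorem of calculus applies. *)
Lemma real_H2_classical a b u du ddu c : a < b ->
  {within `[a, b], continuous c} -> real_H2 a b u du ddu ->
  {ae mu, forall x, x \in `[a, b] -> ddu x = c x * u x} ->
  [/\ {within `[a, b], continuous u}, {within `[a, b], continuous du} &
      {in `]a, b[, forall x, is_derive x 1 u (du x) /\ is_derive x 1 du (c x * u x)}].
Proof.
move=> ab cc [mdd idd2 hdu hu] hae.
have mI : measurable (`[a, b] : set (measurableTypeR R)) by [].
have idd : mu.-integrable `[a, b] (EFin \o ddu).
  apply: (le_integrable mI (g := fun x => (1 + ddu x ^+ 2)%:E)).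
  - exact/measurable_EFinP.
  - move=> x _; rewrite /= lee_fin [leRHS]ger0_norm ?addr_ge0 ?sqr_ge0 //.
    have : 0 <= (`|ddu x| - 1) ^+ 2 by exact: sqr_ge0.
    rewrite sqrrB real_normK ?num_real // expr1n mulr1; have := sqr_ge0 (ddu x); lra.
  - have i1 : mu.-integrable `[a, b] (EFin \o cst 1).
      apply: continuous_compact_integrable; first exact: segment_compact.
      by apply: continuous_subspaceT => x; exact: cvg_cst.
    exact: (integrableD mI i1 idd2).
have cdu := primitive_continuous ab idd hdu.
have idu : mu.-integrable `[a, b] (EFin \o du).
  by apply: continuous_compact_integrable => //; exact: segment_compact.
have cu := primitive_continuous ab idu hu.
have ccu : {within `[a, b], continuous (fun x => c x * u x)}.
  by move=> x; apply: cvgM; [exact: cc|exact: cu].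
split=> // x xab; split; first exact: primitive_derive cdu hu _ xab.
apply: (primitive_derive ab ccu) xab => y yab.
rewrite hdu //; congr (_ + fine _).
have sub : `[a, y] `<=` `[a, b].
  by apply: subset_itvl; rewrite bnd_simp; move: yab; rewrite in_itv => /andP[].
apply: ae_eq_integral => //.
- by apply/measurable_EFinP; exact: measurable_funS mdd.
- apply/measurable_EFinP; apply: (measurable_funS mI sub).
  exact: subspace_continuous_measurable_fun.
- apply: (@filterS _ _ (ae_filter_ringOfSetsType mu) _ _ _ hae) => z hz zay.
  by rewrite /= hz //; exact: sub.
Qed.

End regularity.

(** * Gluing at the origin and classical functions in H^2 *)

Section gluing.
Variable R : realType.
Notation mu := (@lebesgue_measure R).
Implicit Types (f g df dg u du ddu : R -> R) (a b : R).

Lemma is_derive_glue f g df dg : (forall x : R, is_derive x 1 f (df x)) ->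
  (forall x : R, is_derive x 1 g (dg x)) -> f 0 = g 0 -> df 0 = dg 0 ->
  forall x : R, is_derive x 1 (fun x => if x <= 0 then f x else g x)
    (if x <= 0 then df x else dg x).
Proof.
move=> hf hg fg0 dfg0 x; case: (ltgtP x 0) => [x0|x0|->].
- apply: near_eq_is_derive (hf x).
  by near=> y; rewrite ifT // ltW //; near: y; exact: lt_nbhsl.
- apply: near_eq_is_derive (hg x).
  by near=> y; rewrite ifF // leNgt; apply/negbTE/negPn; near: y; exact: lt_nbhsr.
set F := fun x => _.
have quot (h dh : R -> R) : is_derive (0 : R) 1 h (dh 0) ->
    r^-1 *: ((h \o shift 0) (r *: 1) - h 0) @[r --> (0 : R)^'] --> dh 0.
  by case=> hd <-; exact: hd.
have qf := quot _ _ (hf 0); have := quot _ _ (hg 0); rewrite -dfg0 => qg.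
have qF : r^-1 *: ((F \o shift 0) (r *: 1) - F 0) @[r --> (0 : R)^'] --> df 0.
  apply/cvgrPdist_lt => eps eps0.
  have /cvgrPdist_lt /(_ _ eps0) nf := qf.
  have /cvgrPdist_lt /(_ _ eps0) ng := qg.
  near=> r; have hnf : `|df 0 - r^-1 *: ((f \o shift 0) (r *: 1) - f 0)| < eps by near: r.
  have hng : `|df 0 - r^-1 *: ((g \o shift 0) (r *: 1) - g 0)| < eps by near: r.
  (* On either side of 0 the difference quotient of [F] is that of [f] or that of [g], and both have
     the same limit. *)
  by rewrite /F /= lexx; case: ifP => _ //; rewrite fg0.
by apply: DeriveDef; [apply/cvg_ex; exists (df 0)|exact: cvg_lim qF].
Unshelve. all: by end_near. Qed.

Lemma classical_real_H2 a b u du ddu :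
  (forall x : R, is_derive x 1 u (du x)) -> (forall x : R, is_derive x 1 du (ddu x)) ->
  continuous ddu -> real_H2 a b u du ddu.
Proof.
move=> hu hdu cddu.
have FTC f df : (forall x : R, is_derive x 1 f (df x)) -> continuous df ->
    {in `[a, b], forall x, f x = f a + \int[mu]_(t in `[a, x]) df t}.
  move=> hf cdf x; rewrite in_itv /= => /andP[+ xb].
  rewrite le_eqVlt => /predU1P[<-|ax].
    by rewrite set_itv1 Rintegral_set1 addr0.
  rewrite /Rintegral (@continuous_FTC2 _ df f) //=.
  - by rewrite subrKC.
  - exact: continuous_subspaceT.
  - split.
    + by move=> y _; exact: (@ex_derive _ _ _ _ _ _ _ (hf y)).
    + apply: cvg_at_right_filter; exact: is_derive_continuous (hf a).
    + apply: cvg_at_left_filter; exact: is_derive_continuous (hf x).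
  - by move=> y _; rewrite derive1E; exact: (@derive_val _ _ _ _ _ _ _ (hf y)).
have cdu : continuous du by move=> x; exact: is_derive_continuous (hdu x).
split; [|
  |exact: FTC|exact: FTC].
- apply: measurable_funTS; exact: continuous_measurable_fun.
- apply: continuous_compact_integrable; first exact: segment_compact.
  by apply: continuous_subspaceT => x; apply: cvgM; exact: cddu.
Qed.

Lemma within_comp (A B : set R) f g : {within A, continuous f} ->
  (forall x, B x -> A (g x)) -> continuous g -> {within B, continuous (f \o g)}.
Proof.
move=> /subspace_continuousP cf BA cg; apply/subspace_continuousP => x Bx.
apply: cvg_comp (cf _ (BA _ Bx)) => P.
rewrite /within /= => hP.
have cgx : \forall y \near x, A (g y) -> P (g y) by exact: (cg x _ hP).
have : \forall y \near x, B y -> P (g y).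
  by apply: filterS cgx => y h By; exact/h/BA.
exact.
Qed.

End gluing.

(** * Bloch eigenvalues and secular equations *)

Section eigenvalues.
Variables (R : realType) (p : params R).
Notation mu := (@lebesgue_measure R).

(** This is lam = 1 / h^2, as [coupling_hsc] proves. *)
Definition coupling : R := 2 * mass p * L0 p ^+ 2 * V0 p / hbar p ^+ 2.

Lemma coupling_gt0 : 0 < coupling.
Proof.
by rewrite /coupling !(mulr_gt0, invr_gt0, exprn_gt0) ?mass_gt0 ?L0_gt0 ?V0_gt0 ?hbar_gt0.
Qed.

(* The Schrodinger equation with energy E reads u'' = qcoef E u. *)
Definition qcoef (E x : R) : R :=
  (V0 p * (`|x| / L0 p - 1) - E) / (hbar p ^+ 2 / (2 * mass p)).

Lemma continuous_qcoef E : continuous (qcoef E).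
Proof.
move=> x; apply: cvgMr_tmp; apply: cvgB; last exact: cvg_cst.
apply: cvgMl_tmp; apply: cvgB; last exact: cvg_cst.
by apply: cvgMr_tmp; apply: cvg_norm; exact: cvg_id.
Qed.

Lemma qcoefE e t : 0 <= t ->
  L0 p ^+ 2 * qcoef (V0 p * e) (L0 p * t) = coupling * (t - 1 - e).
Proof.
move=> t0; have L := L0_gt0 p; have m := mass_gt0 p; have h := hbar_gt0 p.
rewrite /qcoef /coupling ger0_norm ?mulr_ge0 // ?ltW //; field.
by rewrite !gt_eqF.
Qed.

Lemma qcoef_even E x : qcoef E (- x) = qcoef E x.
Proof. by rewrite /qcoef normrN. Qed.

Section reflection.
Variables (e tau : R) (v dv ddv : R -> R).
Let L := L0 p.
Hypothesis hv : real_H2 (- L) L v dv ddv.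
Hypothesis eqv : {ae mu, forall x, x \in `[- L, L] -> ddv x = qcoef (V0 p * e) x * v x}.

(** For tau = 1 and tau = -1, twice the even and odd parts of [v] in the variable t = x / L0. The
    [+ 0] matches the form of [is_derive_affine]. *)
Let y t := v (L * t + 0) + tau * v (- L * t + 0).
Let dy t := L * dv (L * t + 0) + tau * (- L * dv (- L * t + 0)).

Lemma reflection_schrodinger :
  [/\ {within `[(0 : R), 1], continuous y}, {within `[(0 : R), 1], continuous dy} &
      {in `](0 : R), 1[, forall t, schrodinger_at coupling e y dy t}].
Proof.
have L0 : 0 < L by exact: L0_gt0.
have LL : - L < L by lra.
have cq : {within `[- L, L], continuous (qcoef (V0 p * e))}.
  by apply: continuous_subspaceT; exact: continuous_qcoef.
have [cv cdv hode] := real_H2_classical LL cq hv eqv.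
have aff (a : R) : continuous (fun t : R => a * t + 0).
  by move=> x; apply: cvgD; [apply: cvgMl_tmp; exact: cvg_id|exact: cvg_cst].
have inL (s t : R) : s = 1 \/ s = - 1 -> t \in `[0, 1] -> `[- L, L]%classic (s * L * t + 0).
  rewrite /= !in_itv /= addr0 => hs /andP[t0 t1].
  by apply/andP; case: hs => ->; split; nra.
have inoL (s t : R) : s = 1 \/ s = - 1 -> t \in `]0, 1[ -> s * L * t + 0 \in `]- L, L[.
  rewrite !in_itv /= addr0 => hs /andP[t0 t1].
  by apply/andP; case: hs => ->; split; nra.
have cp (f : R -> R) (s : R) : s = 1 \/ s = - 1 -> {within `[- L, L], continuous f} ->
    {within `[0, 1], continuous (fun t => f (s * L * t + 0))}.
  move=> hs cf; apply: (@within_comp _ `[- L, L] `[0, 1] f (fun t => s * L * t + 0) cf) => //.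
  by move=> t t01; exact: inL.
have p1 (f : R -> R) : {within `[- L, L], continuous f} ->
    {within `[0, 1], continuous (fun t => f (L * t + 0))}.
  by move=> /(cp f 1 (or_introl erefl)); rewrite mul1r.
have m1 (f : R -> R) : {within `[- L, L], continuous f} ->
    {within `[0, 1], continuous (fun t => f (- L * t + 0))}.
  by move=> /(cp f (-1) (or_intror erefl)); rewrite mulN1r.
split.
- by move=> t; apply: cvgD; [exact: p1|apply: cvgMl_tmp; exact: m1].
- move=> t; apply: cvgD; first by apply: cvgMl_tmp; exact: p1.
  by apply: cvgMl_tmp; apply: cvgMl_tmp; exact: m1.
move=> t t01.
have := inoL 1 _ (or_introl erefl) t01; have := inoL (-1) _ (or_intror erefl) t01.
rewrite mul1r mulN1r => /hode[v1 dv1] /hode[v2 dv2].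
split.
  exact: (is_derive_add (is_derive_affine v2) (is_derive_scale tau (is_derive_affine v1))).
have := is_derive_add (is_derive_scale L (is_derive_affine dv2))
  (is_derive_scale tau (is_derive_scale (- L) (is_derive_affine dv1))).
apply: eq_is_derive; rewrite /y !addr0 (mulNr L t) qcoef_even -qcoefE -/L.
  ring.
by move: t01; rewrite in_itv /= => /andP[/ltW].
Qed.

End reflection.

Section secular.
Variables (phi dphi psi dpsi : R -> R -> R).
Hypothesis F : fundamental coupling phi dphi psi dpsi.

(** At t = 1 the boundary conditions give the parts the value (sigma + tau) v(-L0) and the slope L0
    (sigma - tau) v'(-L0). For sigma = 1 the even part has zero slope and the odd part zero value;
    for sigma = -1 it is the reverse. A nonzero part gives the vanishing factor. *)
Lemma real_eigenfunction_secular (sigma e : R) v dv ddv :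
  real_H2 (- L0 p) (L0 p) v dv ddv ->
  {ae mu, forall x, x \in `[- L0 p, L0 p] -> ddv x = qcoef (V0 p * e) x * v x} ->
  v (L0 p) = sigma * v (- L0 p) -> dv (L0 p) = sigma * dv (- L0 p) ->
  (exists2 x, x \in `[- L0 p, L0 p] & v x != 0) ->
  (sigma = 1 -> dphi e 1 * psi e 1 = 0) /\ (sigma = -1 -> phi e 1 * dpsi e 1 = 0).
Proof.
move=> hv eqv bv bdv [x xL vx0]; have L := L0_gt0 p.
pose y tau t := v (L0 p * t + 0) + tau * v (- L0 p * t + 0).
pose dy tau t := L0 p * dv (L0 p * t + 0) + tau * (- L0 p * dv (- L0 p * t + 0)).
have repr tau : {in `[0, 1], forall t,
    y tau t = y tau 0 * phi e t + dy tau 0 * psi e t /\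
    dy tau t = y tau 0 * dphi e t + dy tau 0 * dpsi e t}.
  by have [c1 c2 h] := reflection_schrodinger tau hv eqv; exact (fundamental_repr F c1 c2 h).
have one01 : (1 : R) \in `[0, 1] by rewrite in_itv /= lexx ler01.
have y1 tau : y tau 1 = (sigma + tau) * v (- L0 p).
  by rewrite /y !mulr1 !addr0 bv; ring.
have dy1 tau : dy tau 1 = L0 p * (sigma - tau) * dv (- L0 p).
  by rewrite /dy !mulr1 !addr0 bdv; ring.
have dyE : dy 1 0 = 0 by rewrite /dy !mulr0 !addr0; ring.
have yO : y (-1) 0 = 0 by rewrite /y !mulr0 !addr0; ring.
have t01 : `|x| / L0 p \in `[0, 1].
  move: xL; rewrite !in_itv /= => hx; rewrite divr_ge0 ?(ltW L) //=.
  by rewrite ler_pdivrMr // mul1r ler_norml.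
have [yE|yE] := eqVneq (y 1 0) 0; last first.
  have [h1 h2] := repr 1 _ one01; move: h1 h2.
  rewrite y1 dy1 dyE !mul0r !addr0 => h1 h2; split=> s.
    have : y 1 0 * dphi e 1 = 0 by rewrite -h2 s; ring.
    by move=> /eqP; rewrite mulf_eq0 (negbTE yE) /= => /eqP ->; rewrite mul0r.
  have : y 1 0 * phi e 1 = 0 by rewrite -h1 s; ring.
  by move=> /eqP; rewrite mulf_eq0 (negbTE yE) /= => /eqP ->; rewrite mul0r.
have [dyO|dyO] := eqVneq (dy (-1) 0) 0; last first.
  have [h1 h2] := repr (-1) _ one01; move: h1 h2.
  rewrite y1 dy1 yO !mul0r !add0r => h1 h2; split=> s.
    have : dy (-1) 0 * psi e 1 = 0 by rewrite -h1 s; ring.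
    by move=> /eqP; rewrite mulf_eq0 (negbTE dyO) /= => /eqP ->; rewrite mulr0.
  have : dy (-1) 0 * dpsi e 1 = 0 by rewrite -h2 s; ring.
  by move=> /eqP; rewrite mulf_eq0 (negbTE dyO) /= => /eqP ->; rewrite mulr0.
(* Both parts have zero data, so the sum and the difference of v(|x|) and v(-|x|) vanish,
   contradicting v x != 0. *)
exfalso; move/negP: vx0; apply; apply/eqP.
have [+ _] := repr 1 _ t01; have [+ _] := repr (-1) _ t01.
have E1 : L0 p * (`|x| / L0 p) = `|x| by field; rewrite gt_eqF.
have E2 : - L0 p * (`|x| / L0 p) = - `|x| by rewrite mulNr E1.
rewrite yE dyE yO dyO !mul0r addr0 /y E1 E2 !addr0.
case: (ger0P x) => _; first by lra.
by rewrite opprK; lra.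
Qed.

(** The multiplier and the coefficients are real, so real and imaginary parts solve the problem
    separately; one of them is nonzero at [x]. *)
Lemma bloch_secular (sigma E : R) : bloch_eigenvalue p (sigma%:C)%C E ->
  let e := E / V0 p in
  (sigma = 1 -> dphi e 1 * psi e 1 = 0) /\ (sigma = -1 -> phi e 1 * dpsi e 1 = 0).
Proof.
move=> [u [du [ddu [[hRe hIm] bu bdu [x xL ux0] hae]]]] e.
have V := V0_gt0 p; have m := mass_gt0 p; have h := hbar_gt0 p.
have Ee : V0 p * e = E by rewrite mulrC divfK ?gt_eqF.
have solve (x1 x2 : R) y1 : x1 \in `[- L0 p, L0 p] ->
    - (hbar p ^+ 2 / (2 * mass p)) * x2 + potential p x1 * y1 = E * y1 ->
    x2 = qcoef (V0 p * e) x1 * y1.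
  rewrite in_itv /= Ee => x1L; rewrite potentialE // /qcoef => H.
  have k0 : hbar p ^+ 2 / (2 * mass p) != 0.
    by rewrite gt_eqF // divr_gt0 ?exprn_gt0 ?mulr_gt0.
  rewrite mulrAC; apply: (canRL (mulfK k0)); move: H; lra.
have eqR (w w' : R[i]) (a b c : R) : (- (a%:C) * w' + b%:C * w = c%:C * w)%C ->
    - a * complex.Re w' + b * complex.Re w = c * complex.Re w /\
    - a * complex.Im w' + b * complex.Im w = c * complex.Im w.
  case: w w' => w1 w2 [w1' w2'] /eqP; rewrite eq_complex /= => /andP[/eqP h1 /eqP h2].
  by split; [move: h1|move: h2]; lra.
have bR (w w' : R[i]) : (w = sigma%:C * w')%C -> complex.Re w = sigma * complex.Re w' /\
    complex.Im w = sigma * complex.Im w'.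
  case: w w' => w1 w2 [w1' w2'] /eqP; rewrite eq_complex /= => /andP[/eqP h1 /eqP h2].
  by split; [move: h1|move: h2]; lra.
have [bRe bIm] := bR _ _ bu; have [bdRe bdIm] := bR _ _ bdu.
have [Rx|Rx] := eqVneq (complex.Re (u x)) 0; last first.
  apply: (real_eigenfunction_secular hRe _ bRe bdRe); last by exists x.
  apply: (@filterS _ _ (ae_filter_ringOfSetsType mu) _ _ _ hae) => z hz zL.
  by apply: solve => //; exact: (eqR _ _ _ _ _ (hz zL)).1.
apply: (real_eigenfunction_secular hIm _ bIm bdIm).
  apply: (@filterS _ _ (ae_filter_ringOfSetsType mu) _ _ _ hae) => z hz zL.
  by apply: solve => //; exact: (eqR _ _ _ _ _ (hz zL)).2.
by exists x => //; move: ux0; rewrite eq_complex /= Rx eqxx.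
Qed.

End secular.

(** Converse of the secular equations: a solution on the half cell is extended by parity [tau]. For
    signs [sigma] and [tau], the conditions at 0 say that the extension is C^1 and those at 1 that
    it satisfies the boundary conditions. *)
Lemma parity_bloch (sigma tau e : R) y dy t0 :
  (forall t, schrodinger_at coupling e y dy t) ->
  y 0 = tau * y 0 -> dy 0 = - tau * dy 0 ->
  y 1 = sigma * tau * y 1 -> dy 1 = - (sigma * tau) * dy 1 ->
  t0 \in `[0, 1] -> y t0 != 0 -> bloch_eigenvalue p (sigma%:C)%C (V0 p * e).
Proof.
move=> hy y0 dy0 y1 dy1 t01 yt0.
have L := L0_gt0 p; have V := V0_gt0 p; have m := mass_gt0 p; have h := hbar_gt0 p.
pose c : R := (L0 p)^-1.
have cL : c * L0 p = 1 by rewrite mulVf ?gt_eqF.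
have c0 : 0 < c by rewrite invr_gt0.
pose q := qcoef (V0 p * e).
pose v x := if x <= 0 then tau * y (- c * x + 0) else y (c * x + 0).
pose dv x := if x <= 0 then tau * (- c * dy (- c * x + 0)) else c * dy (c * x + 0).
pose ddv x := q x * v x.
have hv (x : R) : is_derive x 1 v (dv x).
  apply: (@is_derive_glue _ (fun x => tau * y (- c * x + 0)) (fun x => y (c * x + 0))
    (fun x => tau * (- c * dy (- c * x + 0))) (fun x => c * dy (c * x + 0))).
  - by move=> z; apply: is_derive_scale; apply: is_derive_affine; exact: (hy _).1.
  - by move=> z; apply: is_derive_affine; exact: (hy _).1.
  - by rewrite !mulr0 !addr0.
  - by rewrite !mulr0 !addr0 [in RHS]dy0; ring.
have qc t : 0 <= t -> c ^+ 2 * (coupling * (c * t - 1 - e)) = q t.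
  move=> t0'; rewrite -qcoefE ?mulr_ge0 ?(ltW c0) // mulrA -exprMn cL expr1n mul1r.
  by rewrite mulrA [L0 p * c]mulrC cL mul1r.
have D1 (z : R) : is_derive z 1 (fun x => tau * (- c * dy (- c * x + 0)))
    (tau * (- c * (- c * (coupling * ((- c * z + 0) - 1 - e) * y (- c * z + 0))))).
  by apply: is_derive_scale; apply: is_derive_scale; apply: is_derive_affine; exact: (hy _).2.
have D2 (z : R) : is_derive z 1 (fun x => c * dy (c * x + 0))
    (c * (c * (coupling * ((c * z + 0) - 1 - e) * y (c * z + 0)))).
  by apply: is_derive_scale; apply: is_derive_affine; exact: (hy _).2.
have hdv (x : R) : is_derive x 1 dv (ddv x).
  have := is_derive_glue D1 D2 _ _ x; rewrite !mulr0 !addr0.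
  have e1 : tau * (- c * dy 0) = c * dy 0 by rewrite [in RHS]dy0; ring.
  have e2 : tau * (- c * (- c * (coupling * (0 - 1 - e) * y 0))) =
      c * (c * (coupling * (0 - 1 - e) * y 0)) by rewrite [in RHS]y0; ring.
  move=> /(_ e1 e2); apply: eq_is_derive; rewrite /ddv /v; case: (leP x 0) => x0.
    rewrite !addr0 -[q x]qcoef_even -/q -qc ?oppr_ge0 // mulrN mulNr; ring.
  rewrite !addr0 -qc ?(ltW x0) //; ring.
have cddv : continuous ddv.
  move=> x; apply: cvgM; first exact: continuous_qcoef.
  exact: is_derive_continuous (hv x).
have rH2 := classical_real_H2 (- L0 p) (L0 p) hv hdv cddv.
have zH2 : real_H2 (- L0 p) (L0 p) (cst 0) (cst 0) (cst 0).
  have D0 (x : R) : is_derive x 1 (cst (0 : R)) (cst 0 x) by exact: is_derive_cst.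
  have c0' : continuous (cst (0 : R) : R -> R) by move=> x; exact: cvg_cst.
  exact: (@classical_real_H2 _ _ _ (cst 0) (cst 0) (cst 0) D0 D0 c0').
have vL : v (L0 p) = y 1 by rewrite /v leNgt L /= addr0 cL.
have vNL : v (- L0 p) = tau * y 1.
  by rewrite /v oppr_le0 ltW // mulrNN addr0 cL.
have dvL : dv (L0 p) = c * dy 1 by rewrite /dv leNgt L /= addr0 cL.
have dvNL : dv (- L0 p) = tau * (- c * dy 1).
  by rewrite /dv oppr_le0 ltW // mulrNN addr0 cL.
exists (fun x => (v x)%:C)%C, (fun x => (dv x)%:C)%C, (fun x => (ddv x)%:C)%C; split.
- by split.
- by rewrite -rmorphM /= vL vNL mulrA -y1.
- rewrite -rmorphM /= dvL dvNL; congr (_ %:C)%C.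
  by rewrite [in LHS]dy1; ring.
- exists (L0 p * t0).
    by move: t01; rewrite !in_itv /= => /andP[? ?]; apply/andP; split; nra.
  rewrite eq_complex /= eqxx andbT /v.
  have -> : c * (L0 p * t0) = t0 by rewrite mulrA cL mul1r.
  (* The reflected branch of [v] also covers 0, so t0 = 0 needs the compatibility y 0 = tau y 0. *)
  case: leP => [t0'|_]; last by rewrite addr0.
  have -> : t0 = 0.
    by move: t01; rewrite in_itv /= => /andP[? ?]; nra.
  by rewrite !mulr0 addr0 -y0 (_ : 0 = t0) //; move: t01; rewrite in_itv /= => /andP[? ?]; nra.
- apply: (@aeW _ _ _ mu) => x; rewrite in_itv /= => xL.
  rewrite -rmorphN -!rmorphM -rmorphD /=; congr (_ %:C)%C.
  rewrite potentialE // /ddv /q /qcoef; field.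
  by rewrite !gt_eqF.
Qed.

End eigenvalues.

(** * Band edges *)

Section band_edges.
Variables (R : realType) (p : params R).

Lemma hsc_gt0 : 0 < hsc p.
Proof.
by rewrite /hsc divr_gt0 ?hbar_gt0 // mulr_gt0 ?L0_gt0 // sqrtr_gt0 !mulr_gt0
  ?mass_gt0 ?V0_gt0.
Qed.

Lemma coupling_hsc : coupling p = 1 / hsc p ^+ 2.
Proof.
have L := L0_gt0 p; have V := V0_gt0 p; have m := mass_gt0 p; have h := hbar_gt0 p.
rewrite /hsc expr_div_n exprMn sqr_sqrtr; last by rewrite !mulr_ge0 ?ltW.
by rewrite /coupling; field; rewrite !gt_eqF.
Qed.

(** Both h^(2/3) and theta are cube roots, and h^2 times the radicand of theta is V0^-3. *)
Lemma theta_scaling : hsc p `^ (2 / 3) * (theta p * V0 p) = 1.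
Proof.
have L := L0_gt0 p; have V := V0_gt0 p; have m := mass_gt0 p; have h := hbar_gt0 p.
have H := hsc_gt0.
have x0 : 0 <= 2 * mass p * L0 p ^+ 2 / (hbar p ^+ 2 * V0 p ^+ 2).
  by rewrite divr_ge0 ?mulr_ge0 ?sqr_ge0 // ltW.
rewrite (_ : 2 / 3 = 2%:R * (1 / 3)); last by field.
rewrite powRrM powR_mulrn ?(ltW H) // mulrA /theta -powRM ?sqr_ge0 //.
have -> : hsc p ^+ 2 * (2 * mass p * L0 p ^+ 2 / (hbar p ^+ 2 * V0 p ^+ 2)) = (V0 p)^-1 ^+ 3.
  have -> : hsc p ^+ 2 = 1 / coupling p by rewrite coupling_hsc !div1r invrK.
  by rewrite /coupling; field; rewrite !gt_eqF.
have V1 : 0 <= (V0 p)^-1 by rewrite invr_ge0 ltW.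
rewrite -powR_mulrn // -powRrM (_ : 3%:R * (1 / 3) = 1); last by field.
by rewrite powRr1 // mulVf ?gt_eqF.
Qed.

Lemma leastE (S : set R) (m : R) : S m -> lbound S m -> least S = m.
Proof.
move=> Sm lm; apply: xget_unique; first by split.
by move=> x [Sx lx]; apply/eqP; rewrite eq_le lx // lm.
Qed.

(** By [theta_scaling] the left-hand quantity is the dimensionless [e0] of [periodic_least], whose
    eigenfunction is the even extension of [phi e0]. *)
Lemma rEmin0_expansion : coupling p <= 1 / 12 ->
  `|hsc p `^ (2 / 3) * rEmin0 p - (- (1 / 2) - 1 / 120 * (1 / hsc p ^+ 2))|
    <= 2 * (1 / hsc p ^+ 4).
Proof.
move=> small; have V := V0_gt0 p.
have [phi [dphi [psi [dpsi F]]]] := fundamental_exists (coupling p).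
have lam : 0 < coupling p <= 1 / 12 by rewrite coupling_gt0.
have [e0 [e0z e0least e0exp]] := periodic_least F lam.
have E : Emin0 p = V0 p * e0.
  apply: leastE.
    have one01 : (0 : R) \in `[0, 1] by rewrite in_itv /= lexx ler01.
    have := @parity_bloch _ p 1 1 e0 (phi e0) (dphi e0) 0.
    rewrite !mul1r !mulN1r (fund_phi0 F) (fund_dphi0 F) e0z oppr0.
    by apply => //; exact: (fund_phi F).
  move=> x /(bloch_secular F)[/(_ erefl) /e0least + _].
  by rewrite ler_pdivlMr // mulrC.
rewrite /rEmin0 E (_ : _ * (theta p * _) = e0); last first.
  by rewrite (mulrA (theta p)) mulrA theta_scaling mul1r.
move: e0exp; rewrite coupling_hsc.
congr (_ <= _); [congr (`|_ - (_ - _)|)|]; field; exact: lt0r_neq0 hsc_gt0.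
Qed.

(** The dimensionless edge is at least h^2 / 4, and theta V0 = h^(-2/3) >= 1 / h for h >= 1; this
    crude bound suffices for divergence. *)
Lemma rEmax0_lower : coupling p <= 1 / 12 -> 1 <= hsc p -> hsc p / 4 <= rEmax0 p.
Proof.
move=> small h1; have V := V0_gt0 p; have H := hsc_gt0.
have [phi [dphi [psi [dpsi F]]]] := fundamental_exists (coupling p).
have lam : 0 < coupling p <= 1 / 12 by rewrite coupling_gt0.
have [e0 [e0z e0least e0low]] := antiperiodic_least F lam.
have one01 : (1 : R) \in `[0, 1] by rewrite in_itv /= lexx ler01.
have zero01 : (0 : R) \in `[0, 1] by rewrite in_itv /= lexx ler01.
have E : Emax0 p = V0 p * e0.
  apply: leastE; last first.
    move=> x; rewrite -[X in bloch_eigenvalue p X]/(- 1) => hx.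
    have hx' : bloch_eigenvalue p ((-1 : R)%:C)%C x by rewrite rmorphN1.
    have [_ /(_ erefl) /e0least] := bloch_secular F hx'.
    by rewrite ler_pdivlMr // mulrC.
  rewrite (_ : -1 = ((-1 : R)%:C)%C); last by rewrite rmorphN1.
  (* If phi vanishes at 1 the eigenfunction is even; if dpsi does, it is odd, and its nonzero point
     is t = 1 because psi(0) = 0. *)
  move/eqP: e0z; rewrite mulf_eq0 => /orP[]/eqP z.
    apply: (@parity_bloch _ p (-1) 1 e0 (phi e0) (dphi e0) 0) => //.
    - exact: (fund_phi F).
    - by rewrite mul1r.
    - by rewrite (fund_dphi0 F) mulr0.
    - by rewrite z mulr0.
    - by ring.
    - by rewrite (fund_phi0 F) oner_neq0.
  have psi1 : psi e0 1 != 0.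
    have c1 : {within `[(0 : R), 1], continuous (psi e0)}.
      by apply: within_continuous => x; exact: is_derive_continuous (fund_psi F e0 x).1.
    have c2 : {within `[(0 : R), 1], continuous (dpsi e0)}.
      by apply: within_continuous => x; exact: is_derive_continuous (fund_psi F e0 x).2.
    have [_] := fundamental_init F c1 c2 (fun t _ => fund_psi F e0 t) one01.
    rewrite (fund_dpsi0 F) z mul0r sub0r => /eqP; apply: contraTneq => ->.
    by rewrite mul0r oppr0 oner_neq0.
  apply: (@parity_bloch _ p (-1) (-1) e0 (psi e0) (dpsi e0) 1) => //.
  - exact: (fund_psi F).
  - by rewrite (fund_psi0 F) mulr0.
  - by ring.
  - by ring.
  - by rewrite z mulr0.
have S := theta_scaling.
have hle : hsc p `^ (2 / 3) <= hsc p by apply: ler1_powR => //; lra.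
have hpos : 0 < hsc p `^ (2 / 3) by apply: powR_gt0.
rewrite /rEmax0 E mulrA; set a := theta p * V0 p in S *.
have a0 : 0 < a by rewrite -(pmulr_rgt0 _ hpos) S ltr01.
have ha : 1 <= hsc p * a by rewrite -S; apply: ler_wpM2r => //; exact: ltW.
have e0h : hsc p ^+ 2 / 4 <= e0.
  apply: le_trans e0low; rewrite coupling_hsc.
  by rewrite (_ : 1 / (4 * (1 / hsc p ^+ 2)) = hsc p ^+ 2 / 4) //; field; rewrite gt_eqF.
apply: (@le_trans _ _ (a * (hsc p ^+ 2 / 4))); last by rewrite ler_wpM2l // ltW.
have -> : a * (hsc p ^+ 2 / 4) = (hsc p * a) * (hsc p / 4) by ring.
by rewrite ler_peMl // divr_ge0 // ltW.
Qed.

End band_edges.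

(** * Passage to the limit of large h *)

Lemma hsc_pinfty_ge (R : realType) (M : R) (P : set (params R)) :
  (forall p, M <= hsc p -> P p) -> hsc_pinfty P.
Proof.
move=> MP; apply: (@filterS _ _ _ _ _ _ (nbhs_pinfty_ge (num_real M))) => h Mh p hp.
by apply: MP; rewrite hp.
Qed.

Lemma coupling_small (R : realType) (p : params R) : 4 <= hsc p -> coupling p <= 1 / 12.
Proof.
move=> h4; have H := hsc_gt0 p.
rewrite coupling_hsc ler_pdivrMr ?exprn_gt0 //; nra.
Qed.

Theorem theorem3 (R : realType) :
  [/\ hsc p `^ (2 / 3) * rEmin0 p @[p --> @hsc_pinfty R] --> - (1 / 2 : R),
      rEmax0 p @[p --> @hsc_pinfty R] --> +oo &
      (fun p : params R => hsc p `^ (2 / 3) * rEmin0 p : R^o) =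
      (fun p : params R => - (1 / 2) - 1 / 120 * (1 / hsc p ^+ 2) : R^o)
      +O_ (@hsc_pinfty R) (fun p : params R => 1 / hsc p ^+ 4 : R^o)].
Proof.
split.
- apply/cvgrPdist_le => eps eps0.
  (* With i = 1 / h at most 1/4 and at most eps, the deviation i^2 / 120 + 2 i^4 is below i^2 <= i /
     4 <= eps. *)
  apply: (@hsc_pinfty_ge _ (Num.max 4 eps^-1)) => p; rewrite ge_max => /andP[h4 heps].
  have H := hsc_gt0 p; have := rEmin0_expansion (coupling_small h4).
  set i := (hsc p)^-1.
  have i0 : 0 < i by rewrite invr_gt0.
  have i4 : i <= 1 / 4.
    by rewrite /i -div1r ler_pdivrMr //; lra.
  have ieps : i <= eps by rewrite /i invf_ple.
  rewrite !div1r -!exprVn -/i ler_norml ler_norml => /andP[h1 h2].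
  have i2 : i ^+ 2 <= i / 4 by nra.
  have i2' : 0 <= i ^+ 2 by exact: sqr_ge0.
  have i4' : i ^+ 4 <= i ^+ 2 / 4.
    have -> : i ^+ 4 = i ^+ 2 * (i * i) by ring.
    nra.
  by apply/andP; split; lra.
- apply/cvgryPge => A.
  apply: (@hsc_pinfty_ge _ (Num.max 4 (4 * A))) => p; rewrite ge_max => /andP[h4 hA].
  apply: le_trans (rEmax0_lower (coupling_small h4) _); last by lra.
  by rewrite ler_pdivlMr // mulrC.
(* Any k >= 2 serves, 2 being the constant of [rEmin0_expansion]. *)
apply/eqaddOP; near=> k.
apply: (@hsc_pinfty_ge _ 4) => p h4; have H := hsc_gt0 p.
apply: le_trans (rEmin0_expansion (coupling_small h4)) _.
rewrite [X in _ <= _ * X]ger0_norm ?divr_ge0 ?exprn_ge0 ?(ltW H) //.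
apply: ler_wpM2r; first by rewrite divr_ge0 ?exprn_ge0 ?(ltW H).
by near: k; exact: nbhs_pinfty_ge.
Unshelve. all: by end_near. Qed.
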